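(* For $i=1,2$ let $R_i$ be a unital ring whose additive group is finitely generated and torsion-free, $M_i\subseteq R_i^\times$ an abelian submonoid such that ${\rm span}_{\mathbb Z}(M_i)$ has finite index in $R_i$, and $\mathcal L_i\subseteq R_i$ a full rank subgroup invariant under left multiplication by $M_i$. Assume that there is $a\in M_1$ such that $x\mapsto(1-a)x$ is injective on $\mathcal L_1$, and similarly there is $a'\in M_2$ such that $x\mapsto(1-a')x$ is injective on $\mathcal L_2$. If the topological groupoids $(M_1^{-1}\mathcal L_1\rtimes\langle M_1\rangle)\ltimes\overline{\mathcal L_1}$ and $(M_2^{-1}\mathcal L_2\rtimes\langle M_2\rangle)\ltimes\overline{\mathcal L_2}$ are isomorphic, then there are $\mathbb Q$-algebra isomorphisms $\varphi_1\colon\mathbb QR_1\to\mathbb QR_2$ and $\varphi_2\colon\mathbb QR_2\to\mathbb QR_1$ with $\varphi_1(M_1)\subseteq\widetilde{M_2}$ and $\varphi_2(M_2)\subseteq\widetilde{M_1}$.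
   Context: $\mathbb QR=\mathbb Q\otimes_{\mathbb Z}R$; $R^\times$ is the monoid of left regular elements; $\langle M\rangle$ is the subgroup of $(\mathbb QR)^*$ generated by $M$; full rank means ${\rm rk}\,\mathcal L={\rm rk}\,R$; $M^{-1}\mathcal L=\bigcup_{a\in M}a^{-1}\mathcal L\subseteq\mathbb QR$. $\mathcal O$ is the set of elements of $\mathbb QR$ integral over $\mathbb Z$, and $\widetilde M=\langle M\rangle\cap\mathcal O$. The constructible subgroups of $M\curvearrowright\mathcal L$ form the smallest family of subgroups of $\mathcal L$ containing $\mathcal L$ and closed under $C\mapsto aC$ and $C\mapsto\{x\in\mathcal L:ax\in C\}$ ($a\in M$); they have finite index and $\overline{\mathcal L}=\varprojlim_C\mathcal L/C$. The group $M^{-1}\mathcal L\rtimes\langle M\rangle$ acts on $M^{-1}\mathcal L$ by $(b,u).x=b+ux$; its restriction to $\mathcal L$ is a partial action that extends uniquely to a partial action on $\overline{\mathcal L}$ by homeomorphisms between open sets, and the groupoid is its partial transformation groupoid. *)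

(* Defs.v *)
(* QR is modelled as a finite-dimensional Q-algebra
   A : falgType rat, and R as a full Z-lattice in A which is a unital subring. *)
From HB Require Import structures.
From mathcomp Require Import all_boot all_order all_algebra all_field.
From Stdlib Require List.
Set Implicit Arguments. Unset Strict Implicit. Unset Printing Implicit Defensive.
Import GRing.Theory.
Local Open Scope ring_scope.

Section Defs.
Variable A : falgType rat.

Definition zcomb (s : seq A) (x : A) : Prop :=
  exists z : 'I_(size s) -> int, x = \sum_(i < size s) s`_i *~ z i.

(* R is a unital subring of A whose additive group is finitely generated
   (torsion-free automatically) and whose Q-span is A, so that A = Q (x)_Z R. *)
Definition is_lattice_order (R : A -> Prop) : Prop :=
  [/\ R 1,
      (forall x y, R x -> R y -> R (x - y)),
      (forall x y, R x -> R y -> R (x * y)) &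
      exists s : seq A, (forall x, R x <-> zcomb s x) /\ (<<s>>%VS = fullv)].

Definition left_regular (R : A -> Prop) (a : A) : Prop :=
  R a /\ forall x, R x -> a * x = 0 -> x = 0.

Definition abelian_submonoid_reg (R M : A -> Prop) : Prop :=
  [/\ M 1,
      (forall a b, M a -> M b -> M (a * b)),
      (forall a b, M a -> M b -> a * b = b * a) &
      (forall a, M a -> left_regular R a)].

Definition zspan (M : A -> Prop) (x : A) : Prop :=
  exists s : seq A, (forall a, a \in s -> M a) /\ zcomb s x.

Definition finite_index_in (R S : A -> Prop) : Prop :=
  exists t : seq A, forall r, R r -> exists2 c, c \in t & S (r - c).

Definition subgroup_of (R L : A -> Prop) : Prop :=
  [/\ L 0, (forall x y, L x -> L y -> L (x - y)) & (forall x, L x -> R x)].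

(* rank of a subgroup of the lattice R = dimension of its Q-span;
   rk R = \dim A *)
Definition full_rank (L : A -> Prop) : Prop :=
  exists s : seq A, (forall x, x \in s -> L x) /\
                    \dim <<s>>%VS = \dim (fullv : {vspace A}).

Definition left_invariant (M L : A -> Prop) : Prop :=
  forall a x, M a -> L x -> L (a * x).

Inductive gen_group (M : A -> Prop) : A -> Prop :=
| gg1 : gen_group M 1
| ggM a : M a -> gen_group M a
| ggmul a b : gen_group M a -> gen_group M b -> gen_group M (a * b)
| gginv a : gen_group M a -> gen_group M a^-1.

Definition MinvL (M L : A -> Prop) (b : A) : Prop :=
  exists a x, M a /\ L x /\ b = a^-1 * x.

Definition integral_over_Z (x : A) : Prop :=
  exists p : {poly int}, p \is monic /\ (map_poly intr p).[x] = 0.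

Definition Mtilde (M : A -> Prop) (x : A) : Prop :=
  gen_group M x /\ integral_over_Z x.

Inductive constructible (M L : A -> Prop) : (A -> Prop) -> Prop :=
| consL : constructible M L L
| consMul a C : M a -> constructible M L C ->
    constructible M L (fun y => exists2 c, C c & y = a * c)
| consPre a C : M a -> constructible M L C ->
    constructible M L (fun x => L x /\ C (a * x)).

(* A point of  Lbar = lim_C L/C  is a compatible family C |-> xi C of cosets
   x + C (x in L), indexed by the constructible subgroups C (xi D is empty for
   non-constructible D, which makes the representation unique). *)
Definition cpt := (A -> Prop) -> (A -> Prop).

Definition is_point (M L : A -> Prop) (xi : cpt) : Prop :=
  [/\ (forall D, ~ constructible M L D -> forall y, ~ xi D y),
      (forall C, constructible M L C ->
         exists2 x, L x & forall y, xi C y <-> (L y /\ C (y - x))) &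
      (forall C D, constructible M L C -> constructible M L D ->
         (forall y, C y -> D y) -> forall y, xi C y -> xi D y)].

Definition iota (M L : A -> Prop) (x : A) : cpt :=
  fun C y => constructible M L C /\ L y /\ C (y - x).

(* xi and eta have the same image in L/C for every C in Cs;
   these sets (Cs finite) form a basis of the inverse limit topology *)
Definition agree (Cs : list (A -> Prop)) (xi eta : cpt) : Prop :=
  forall C, List.In C Cs -> forall y, xi C y <-> eta C y.

Definition inP (M L : A -> Prop) (g : A * A) : Prop :=
  MinvL M L g.1 /\ gen_group M g.2.

Definition Pmul (g h : A * A) : A * A := (g.1 + g.2 * h.1, g.2 * h.2).

Definition Pact (g : A * A) (x : A) : A := g.1 + g.2 * x.

Definition Pdom (L : A -> Prop) (g : A * A) (x : A) : Prop :=
  L x /\ L (Pact g x).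

(* The unique continuous extension of the partial action to Lbar:
   ext_act g xi eta  means  xi lies in the closure of the domain of g in Lbar
   and  eta = lim_{x -> xi, x in dom g} g.x . *)
Definition ext_act (M L : A -> Prop) (g : A * A) (xi eta : cpt) : Prop :=
  [/\ is_point M L xi, is_point M L eta,
      (forall Cs, exists x, Pdom L g x /\ agree Cs (iota M L x) xi) &
      (forall Cs, exists Ds, forall x, Pdom L g x ->
          agree Ds (iota M L x) xi -> agree Cs (iota M L (Pact g x)) eta)].

Definition arrow := ((A * A) * cpt)%type.

Definition is_arrow (M L : A -> Prop) (gam : arrow) : Prop :=
  inP M L gam.1 /\ exists eta, ext_act M L gam.1 gam.2 eta.

Definition composable (M L : A -> Prop) (gam2 gam1 : arrow) : Prop :=
  ext_act M L gam1.1 gam1.2 gam2.2.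

Definition amul (gam2 gam1 : arrow) : arrow := (Pmul gam2.1 gam1.1, gam1.2).

(* open subsets of the arrow space (subspace of P_discrete x Lbar) *)
Definition gopen (M L : A -> Prop) (U : arrow -> Prop) : Prop :=
  (forall gam, U gam -> is_arrow M L gam) /\
  forall g xi, U (g, xi) -> exists Cs, forall eta,
      is_arrow M L (g, eta) -> agree Cs xi eta -> U (g, eta).

End Defs.

Definition groupoid_iso (A1 A2 : falgType rat) (M1 L1 : A1 -> Prop)
    (M2 L2 : A2 -> Prop) (Phi : arrow A1 -> arrow A2) : Prop :=
  (forall gam, is_arrow M1 L1 gam -> is_arrow M2 L2 (Phi gam)) /\
      (forall gam del, is_arrow M1 L1 gam -> is_arrow M1 L1 del ->
          Phi gam = Phi del -> gam = del) /\
      (forall gam', is_arrow M2 L2 gam' ->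
          exists2 gam, is_arrow M1 L1 gam & Phi gam = gam') /\
      (forall gam2 gam1, is_arrow M1 L1 gam2 -> is_arrow M1 L1 gam1 ->
          (composable M1 L1 gam2 gam1 <->
           composable M2 L2 (Phi gam2) (Phi gam1))) /\
      (forall gam2 gam1, is_arrow M1 L1 gam2 -> is_arrow M1 L1 gam1 ->
          composable M1 L1 gam2 gam1 ->
          Phi (amul gam2 gam1) = amul (Phi gam2) (Phi gam1)) /\
      (forall U, gopen M2 L2 U ->
          gopen M1 L1 (fun gam => is_arrow M1 L1 gam /\ U (Phi gam))) /\
      (forall V, gopen M1 L1 V ->
          gopen M2 L2 (fun gam' => exists2 gam, V gam & Phi gam = gam')).

Definition groupoids_isomorphic (A1 A2 : falgType rat) (M1 L1 : A1 -> Prop)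
    (M2 L2 : A2 -> Prop) : Prop :=
  exists Phi, groupoid_iso M1 L1 M2 L2 Phi.

Definition Qalg_iso (A1 A2 : falgType rat) (phi : A1 -> A2) : Prop :=
  [/\ (forall x y, phi (x + y) = phi x + phi y),
      (forall (c : rat) x, phi (c *: x) = c *: phi x),
      (forall x y, phi (x * y) = phi x * phi y),
      phi 1 = 1 & bijective phi].

Definition good_triple (A : falgType rat) (R M L : A -> Prop) : Prop :=
  [/\ is_lattice_order R, abelian_submonoid_reg R M,
      finite_index_in R (zspan M) &
      [/\ subgroup_of R L, full_rank L & left_invariant M L]].

(* Main.v *)
From HB Require Import structures.
From mathcomp Require Import all_boot all_order all_algebra all_field.
From mathcomp Require Import boolp classical_sets filter.
Require Import Defs.

(** A groupoid isomorphism yields a continuous cocycle [c(g, x)] with values in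
    the group [P2 = M2^-1 L2 x| <M2>].  Since [L1bar] is compact, the cocycle of a
    finite set of translations depends only on [x] modulo a finite index subgroup
    of [L1]; hence [r |-> c(r, 0)] is an injective homomorphism from a finite index
    subgroup of [L1] to [P2].  As [a.0 = 0] for [a] in [M1], it intertwines
    multiplication by [a] with conjugation by [c(a, 0)], at least on a smaller
    finite index subgroup.  Since [<M2>] is abelian, the [<M2>]-component is
    trivial on multiples of [1 - a], and choosing [a] with [1 - a] injective leaves
    an injective additive map from a finite index subgroup to [M2^-1 L2] along
    which [a] acts as some [mu a] in [<M2>].  It extends to an injective linear map
    [f : QR1 -> QR2]; the inverse isomorphism gives one back, so [f] is bijective.
    As [M1] spans [QR1], the map [x |-> f x / f 1] is an algebra isomorphism
    sending [a] to [mu a], which is integral because [a] lies in the order [R1]. *)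

Set Implicit Arguments. Unset Strict Implicit. Unset Printing Implicit Defensive.
Import GRing.Theory Num.Theory Order.TTheory.
Local Open Scope classical_set_scope.
Local Open Scope ring_scope.

(** * Finite families, rational vector spaces and additive subgroups *)

Lemma common_multiple (T : eqType) (P : T -> nat -> Prop) (s : seq T) :
    (forall x n m, (0 < m)%N -> P x n -> P x (n * m)%N) ->
    (forall x, x \in s -> exists2 n, (0 < n)%N & P x n) ->
  exists2 n, (0 < n)%N & forall x, x \in s -> P x n.
Proof.
move=> Pmul; elim: s => [|a s IH] Ps; first by exists 1%N.
have [|n n0 Pn] := IH; first by move=> x xs; apply: Ps; rewrite inE xs orbT.
have [m m0 Pm] := Ps a (mem_head _ _).
exists (n * m)%N; first by rewrite muln_gt0 n0.
move=> x; rewrite inE => /orP[/eqP->|/Pn Px]; last exact: Pmul.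
by rewrite mulnC; apply: Pmul.
Qed.

Section QVectorSpace.
Variable V : lmodType rat.

Lemma mulrn_inj n : (0 < n)%N -> injective (fun x : V => x *+ n).
Proof.
move=> n0 x y /=; rewrite -!scaler_nat; apply: scalerI.
by rewrite pnatr_eq0 -lt0n.
Qed.

Lemma rat_scale_denq (c : rat) (x : V) : (c *: x) *~ denq c = x *~ numq c.
Proof.
by rewrite -!scaler_int scalerA mulrC -{1}(divq_num_den c) mulfVK // intr_eq0 denq_neq0.
Qed.

End QVectorSpace.

Definition additive_subgroup (A : zmodType) (G : A -> Prop) : Prop :=
  G 0 /\ forall x y, G x -> G y -> G (x - y).

Section AdditiveSubgroup.
Variables (A : zmodType) (G : A -> Prop).
Hypothesis gG : additive_subgroup G.

Lemma subgroup0 : G 0. Proof. by case: gG. Qed.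

Lemma subgroupB x y : G x -> G y -> G (x - y).
Proof. by case: gG => _; apply. Qed.

Lemma subgroupN x : G x -> G (- x).
Proof. by move=> Gx; rewrite -sub0r; apply: subgroupB Gx; apply: subgroup0. Qed.

Lemma subgroupD x y : G x -> G y -> G (x + y).
Proof. by move=> Gx Gy; rewrite -[y]opprK; apply/subgroupB/subgroupN. Qed.

Lemma subgroupMn x n : G x -> G (x *+ n).
Proof.
move=> Gx; elim: n => [|n IH]; first by rewrite mulr0n; apply: subgroup0.
by rewrite mulrS; apply: subgroupD.
Qed.

Lemma subgroupMz x z : G x -> G (x *~ z).
Proof.
move=> Gx; case: z => n; first exact: subgroupMn.
by rewrite NegzE mulrNz; apply/subgroupN/subgroupMn.
Qed.

Lemma subgroup_additiveMn (B : zmodType) (f : A -> B) x n :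
  (forall y z, G y -> G z -> f (y + z) = f y + f z) -> G x -> f (x *+ n) = f x *+ n.
Proof.
move=> fD Gx; elim: n => [|n IH]; last first.
  by rewrite !mulrS fD ?IH //; apply: subgroupMn.
rewrite !mulr0n; apply: (addrI (f 0)).
by rewrite -fD ?addr0 //; apply: subgroup0.
Qed.

End AdditiveSubgroup.

(** * Integer combinations of a finite family *)

Section IntegerCombinations.
Variable A : falgType rat.
Implicit Types (s : seq A) (G : A -> Prop).

Lemma zcomb_subgroup s G x :
  additive_subgroup G -> (forall y, y \in s -> G y) -> zcomb s x -> G x.
Proof.
move=> gG Gs [z ->]; elim/big_ind: _ => [|u v|i _].
- exact: subgroup0.
- exact: subgroupD.
- by apply: subgroupMz => //; apply/Gs/mem_nth.
Qed.

Lemma zcomb_cons a s x :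
  zcomb (a :: s) x <-> exists z y, zcomb s y /\ x = a *~ z + y.
Proof.
split=> [[z ->]|[z [y [[w ->] ->]]]].
  rewrite big_ord_recl /=; exists (z ord0).
  by eexists; split; last reflexivity; exists (fun i => z (lift ord0 i)).
exists (fun i => if unlift ord0 i is Some j then w j else z).
rewrite big_ord_recl unlift_none; congr (_ + _).
by apply: eq_bigr => i _; rewrite liftK.
Qed.

Lemma mem_zcomb s x : x \in s -> zcomb s x.
Proof.
elim: s => // a s IH; rewrite inE => /orP[/eqP->|/IH sx]; apply/zcomb_cons.
  exists 1, 0; rewrite addr0; split=> //.
  by exists (fun _ => 0); rewrite big1.
by exists 0, x; rewrite add0r.
Qed.

(** Euclidean division of every coefficient by [m]: the representatives are the combinations with
    coefficients in [[0, m)]. *)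
Lemma zcomb_finite_mod s m : (0 < m)%N ->
  exists t : seq A, forall x, zcomb s x ->
    exists c y, [/\ c \in t, zcomb s y & x - c = y *+ m].
Proof.
move=> m0; elim: s => [|a s [t Ht]].
  exists [:: 0] => x [z ->]; rewrite big_ord0; exists 0, 0.
  by rewrite mem_head subr0 mul0rn; split => //; exists z; rewrite big_ord0.
exists [seq a *+ i + c | i <- seq.iota 0 m, c <- t] => x.
case/zcomb_cons => z [y [/Ht [c [y' [ct sy' e]]] ->]].
have [i iE] : exists i : nat, (z %% m)%Z = i.
  by exists `|(z %% m)%Z|%N; rewrite gez0_abs // modz_ge0 // eqz_nat -lt0n.
have im : (i < m)%N by rewrite -ltz_nat -iE ltz_pmod.
exists (a *+ i + c), (a *~ (z %/ m)%Z + y'); split.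
- by apply: allpairs_f => //; rewrite mem_iota.
- by apply/zcomb_cons; exists (z %/ m)%Z, y'.
rewrite {1}(divz_eq z m) iE mulrzDr mulrzA mulrnDl -e.
by rewrite -!pmulrn opprD addrA [_ + y]addrAC addrK -addrA.
Qed.

(** The product of the denominators of the coordinates is a suitable multiplier. *)
Lemma span_clear_denominators s G x :
    additive_subgroup G -> (forall y, y \in s -> G y) -> x \in <<s>>%VS ->
  exists2 k, (0 < k)%N & G (x *+ k).
Proof.
move=> gG Gs; rewrite -[s]/(tval (in_tuple s)) => /coord_span->.
elim/big_ind: _ => [|u v [k k0 Gu] [l l0 Gv]|i _].
- by exists 1%N => //; rewrite mul0rn; apply: subgroup0.
- exists (k * l)%N; first by rewrite muln_gt0 k0.
  rewrite mulrnDl mulrnA mulnC mulrnA.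
  by apply: subgroupD => //; apply: subgroupMn.
set c := coord _ _ _; exists `|denq c|%N; first by rewrite absz_gt0 denq_neq0.
rewrite pmulrn -[X in _ *~ X]/(`|denq c|%N : int) absz_denq rat_scale_denq.
by apply: subgroupMz => //; apply/Gs/mem_nth.
Qed.

End IntegerCombinations.

(** * Orders: denominators, units and integrality *)

Section Lattice.
Variables (A : falgType rat) (R : A -> Prop).
Hypothesis oR : is_lattice_order R.

Lemma order_subgroup : additive_subgroup R.
Proof. by case: oR => R1 RB _ _; split=> //; rewrite -(subrr 1); apply: RB. Qed.

Lemma order_mul x y : R x -> R y -> R (x * y).
Proof. by case: oR => _ _ + _; apply. Qed.

Lemma order1 : R 1. Proof. by case: oR. Qed.

Lemma order_clear_denominators x : exists2 k, (0 < k)%N & R (x *+ k).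
Proof.
have [_ _ _ [s [sR full]]] := oR.
apply: (@span_clear_denominators _ s); first exact: order_subgroup.
  by move=> y /mem_zcomb; apply: (sR y).2.
by rewrite full memvf.
Qed.

(** Clearing denominators makes multiplication by [a] injective on the whole algebra, hence
    surjective by finite dimension; a right inverse is then two-sided by injectivity. *)
Lemma order_regular_unit a :
  (forall x, R x -> a * x = 0 -> x = 0) -> a \is a GRing.unit.
Proof.
move=> ra.
have inja x : a * x = 0 -> x = 0.
  move=> ax0; have [k k0 Rk] := order_clear_denominators x.
  apply: (mulrn_inj k0); rewrite mul0rn; apply: ra => //.
  by rewrite mulrnAr ax0 mul0rn.
have ker0 : lker (amull a) == 0%VS.
  apply/lker0P => x y; rewrite !lfunE /= => e.
  by apply/subr0_eq/inja; rewrite mulrBr e subrr.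
have [y ay] : exists y, a * y = 1.
  exists ((amull a)^-1%VF 1).
  by rewrite -[RHS](lker0_lfunVK ker0) [RHS]lfunE.
apply/unitrP; exists y; split=> //.
by apply/subr0_eq/inja; rewrite mulrBr mulrA ay mul1r mulr1 subrr.
Qed.

(** Cayley-Hamilton for an integer matrix of multiplication by [m] on generators of [R]. They need
    not be independent; it suffices that 1 is one of their combinations. *)
Lemma order_integral m : R m -> integral_over_Z m.
Proof.
move=> Rm; have [_ _ _ [s [sR _]]] := oR.
(* An empty generating family would give [1 = 0]. *)
case n_s: (size s) => [|n].
  have [z z1] := (sR 1).1 order1; case/eqP: (oner_neq0 A).
  by rewrite z1 big1 // => i _; have : (i < 0)%N by rewrite -n_s.
have [Z ZE] : exists Z : 'M[int]_n.+1,
    forall i : 'I_n.+1, m * s`_i = \sum_(j < n.+1) s`_j *~ Z i j.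
  have Zi (i : 'I_n.+1) : exists z : 'I_n.+1 -> int,
      m * s`_i = \sum_(j < n.+1) s`_j *~ z j.
    have /sR: R (m * s`_i).
      by apply/order_mul/sR/mem_zcomb; rewrite // mem_nth // n_s.
    by rewrite /zcomb n_s.
  have [z zE] := choice Zi; exists (\matrix_(i, j) z i j) => i.
  by rewrite zE; apply: eq_bigr => j _; rewrite mxE.
(* Polynomials in [m] act on the generators through the same polynomials in [Z]. *)
have act (p : {poly int}) (i : 'I_n.+1) :
    (map_poly intr p).[m] * s`_i = \sum_(j < n.+1) s`_j *~ horner_mx Z p i j.
  elim/poly_ind: p i => [|p c IH] i.
    by rewrite !rmorph0 horner0 mul0r big1 // => j _; rewrite mxE mulr0z.
  rewrite !rmorphD !rmorphM /= map_polyX map_polyC hornerMXaddC mulrDl -mulrA ZE.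
  rewrite (comm_horner_mx2 Z p 'X) horner_mx_X horner_mx_C mulr_sumr.
  under [X in X + _ = _]eq_bigr => k _ do rewrite mulrzAr IH mulrz_suml.
  under [RHS]eq_bigr => j _ do rewrite !mxE mulrzDr mulrz_sumr.
  rewrite big_split /=; congr (_ + _).
    rewrite exchange_big; apply: eq_bigr => j _; apply: eq_bigr => k _.
    by rewrite -mulrzA mulrC.
  rewrite (bigD1 i) //= big1 ?addr0 => [|j ji].
    by rewrite eqxx /= mulrzl.
  by rewrite eq_sym (negPf ji) mulr0z.
exists (char_poly Z); split; first exact: char_poly_monic.
have [z z1] : zcomb s 1 by apply/sR/order1.
rewrite -[LHS]mulr1 {2}z1 mulr_sumr big1 // => i _.
have i_n : (i < n.+1)%N by rewrite -n_s.
rewrite mulrzAr (act _ (Ordinal i_n)) Cayley_Hamilton big1 ?mul0rz // => j _.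
by rewrite mxE mulr0z.
Qed.

End Lattice.

(** * The monoid, its group of fractions and the lattice *)

Section GoodTriple.
Variables (A : falgType rat) (R M L : A -> Prop).
Hypothesis tRML : good_triple R M L.

Let oR : is_lattice_order R. Proof. by case: tRML. Qed.

Let mM : abelian_submonoid_reg R M. Proof. by case: tRML. Qed.

Lemma monoid1 : M 1. Proof. by case: mM. Qed.

Lemma monoid_mul a b : M a -> M b -> M (a * b).
Proof. by case: mM => _ + _ _; apply. Qed.

Lemma monoid_order a : M a -> R a.
Proof. by case: mM => _ _ _ /[apply]-[]. Qed.

Lemma monoid_unit a : M a -> a \is a GRing.unit.
Proof. by case: mM => _ _ _ /[apply]-[_]; apply: order_regular_unit. Qed.

Lemma gen_group_unit u : gen_group M u -> u \is a GRing.unit.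
Proof.
elim=> [|a|a b _ ua _ ub|a _ ua]; last by rewrite unitrV.
- exact: unitr1.
- exact: monoid_unit.
- by rewrite unitrMl.
Qed.

Lemma lattice_subgroup : additive_subgroup L.
Proof. by case: tRML => _ _ _ [[L0 LB _] _ _]. Qed.

Lemma lattice_order x : L x -> R x.
Proof. by case: tRML => _ _ _ [[_ _ +] _ _]; apply. Qed.

Lemma lattice_mul a x : M a -> L x -> L (a * x).
Proof. by case: tRML => _ _ _ [_ _]; apply. Qed.

(** Finite index of the integer span makes [M] span the algebra over the rationals, by the
    pigeonhole principle on multiples; hence this induction principle. *)
Lemma monoid_Qspan_ind (P : A -> Prop) :
    P 0 -> (forall x y, P x -> P y -> P (x + y)) ->
    (forall (c : rat) x, P x -> P (c *: x)) -> (forall a, M a -> P a) ->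
  forall x, P x.
Proof.
move=> P0 PD PZ PM x.
have gP : additive_subgroup P.
  by split=> // u v Pu Pv; rewrite -scaleN1r; apply/PD/PZ.
have divP y n : (0 < n)%N -> P (y *+ n) -> P y.
  move=> n0 /(PZ n%:R^-1); rewrite -scaler_nat scalerA mulVf ?scale1r //.
  by rewrite pnatr_eq0 -lt0n.
have [k k0 Rx] := order_clear_denominators oR x.
apply: (divP _ _ k0); move: (x *+ k) Rx => r Rr {x k k0}.
have [_ _ [t tP] _] := tRML.
(* There is one more multiple of [r] than there are representatives in [t], so two multiples share
   one and their difference lies in [P]. *)
have cP (i : 'I_(size t).+1) : exists j : 'I_(size t), P (r *+ i - t`_j).
  have [c ct [s [sM sc]]] := tP _ (subgroupMn (order_subgroup oR) i Rr).
  have c_t : (index c t < size t)%N by rewrite index_mem.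
  exists (Ordinal c_t); rewrite /= nth_index //.
  by apply: zcomb_subgroup sc => // y /sM/PM.
have [f fP] := choice cP.
have /injectivePn[i [j ij fij]] : ~~ injectiveb f.
  by apply: contraTN isT => /injectiveP/leq_card; rewrite !card_ord ltnn.
wlog lt_ij : i j ij fij / (i < j)%N => [IH|].
  case: (ltngtP i j) => [|/IH|/val_inj e]; first exact: IH.
    by apply; rewrite // eq_sym.
  by rewrite e eqxx in ij.
apply: (divP _ (j - i)%N); first by rewrite subn_gt0.
rewrite mulrnBr ?(ltnW lt_ij) //.
have := subgroupB gP (fP j) (fP i).
by rewrite fij opprB addrA subrK.
Qed.

(** The commuting elements of [M] span the algebra; induction on each factor in turn. *)
Lemma algebra_commutative (x y : A) : x * y = y * x.
Proof.
move: x y; apply: monoid_Qspan_ind => [y|x x' IH IH' y|c x IH y|a Ma].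
- by rewrite mulr0 mul0r.
- by rewrite mulrDl mulrDr IH IH'.
- by rewrite -scalerAl IH scalerAr.
apply: monoid_Qspan_ind => [|y y' IH IH'|c y IH|b Mb].
- by rewrite mulr0 mul0r.
- by rewrite mulrDl mulrDr IH IH'.
- by rewrite -scalerAl -IH scalerAr.
by case: mM => _ _ + _; apply.
Qed.

Lemma gen_group_fraction u :
  gen_group M u -> exists a b, [/\ M a, M b & u = a^-1 * b].
Proof.
elim=> [|a Ma|x y _ [a [b [Ma Mb ->]]] _ [c [d [Mc Md ->]]]|x _ [a [b [Ma Mb ->]]]].
- by exists 1, 1; rewrite invr1 mulr1; split=> //; apply: monoid1.
- by exists 1, a; rewrite invr1 mul1r; split=> //; apply: monoid1.
- exists (c * a), (b * d); split; [exact: monoid_mul..|].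
  rewrite invrM ?monoid_unit // -!mulrA; congr (_ * _).
  by rewrite mulrA (algebra_commutative b) !mulrA.
- exists b, a; split=> //.
  by rewrite invrM ?unitrV ?monoid_unit // invrK.
Qed.

Lemma MinvL_translate_mul u x y :
  gen_group M u -> MinvL M L x -> MinvL M L y -> MinvL M L (x + u * y).
Proof.
move=> /gen_group_fraction[c [d [Mc Md ->]]] [a [v [Ma [Lv ->]]]] [b [w [Mb [Lw ->]]]].
(* [a * (b * c)] is a common denominator of [a^-1 * v] and [c^-1 * d * (b^-1 * w)]. *)
exists (a * (b * c)), (b * c * v + a * (d * w)).
split; first by do 2?apply: monoid_mul.
split.
  apply: (subgroupD lattice_subgroup); apply: lattice_mul => //.
    exact: monoid_mul.
  exact: lattice_mul.
have uN : a * (b * c) \is a GRing.unit by rewrite !unitrMl ?monoid_unit.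
apply: (mulrI uN); rewrite mulVKr // mulrDr; congr (_ + _).
  by rewrite (algebra_commutative a) -[LHS]mulrA mulVKr ?monoid_unit.
rewrite -!mulrA mulVKr ?monoid_unit //; congr (_ * _).
by rewrite mulrA (algebra_commutative b) -mulrA mulVKr ?monoid_unit.
Qed.

Lemma Pmul_inP g h : inP M L g -> inP M L h -> inP M L (Pmul g h).
Proof.
move=> [g1 g2] [h1 h2]; split; last exact: ggmul.
exact: MinvL_translate_mul.
Qed.

Lemma translation_inP l : L l -> inP M L (l, 1).
Proof.
move=> Ll; split; last exact: gg1.
by exists 1, l; rewrite invr1 mul1r; split; first exact: monoid1.
Qed.

Lemma dilation_inP a : M a -> inP M L (0, a).
Proof.
move=> Ma; split; last exact: ggM.
exists 1, 0; rewrite mulr0; split; first exact: monoid1.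
by split=> //; apply: subgroup0 lattice_subgroup.
Qed.

(** As [L] has full rank, each of the finitely many generators of [R] has a positive multiple in
    [L]. *)
Lemma order_multiple_lattice :
  exists2 k, (0 < k)%N & forall x, R x -> L (x *+ k).
Proof.
have gL := lattice_subgroup; have [_ _ _ [s [sR _]]] := oR.
have [_ _ _ [_ [t [tL dim_t]] _]] := tRML.
have full : <<t>>%VS = fullv by apply/eqP; rewrite eqEdim subvf dim_t /=.
have [|x _|k k0 Lk] := @common_multiple _ (fun x k => L (x *+ k)) s.
- by move=> x n m _ Lx; rewrite mulrnA; apply: subgroupMn.
- by apply: span_clear_denominators gL tL _; rewrite full memvf.
exists k => // x /sR; apply: (@zcomb_subgroup _ s (fun y => L (y *+ k))) Lk.
split=> [|y z Ly Lz]; first by rewrite mul0rn; apply: subgroup0.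
by rewrite mulrnBl; apply: subgroupB.
Qed.

(** * Constructible subgroups *)

Lemma constructible_sub C x : constructible M L C -> C x -> L x.
Proof.
move=> cC; elim: cC x => [//|a D Ma _ IH x [y /IH Ly ->]|a D _ _ _ x []//].
exact: lattice_mul.
Qed.

Lemma constructible_subgroup C : constructible M L C -> additive_subgroup C.
Proof.
have gL := lattice_subgroup.
elim=> [//|a D Ma _ IH|a D Ma _ IH]; split.
- by exists 0; rewrite ?mulr0 //; apply: subgroup0.
- move=> _ _ [x Dx ->] [y Dy ->]; exists (x - y); last by rewrite mulrBr.
  exact: subgroupB.
- by rewrite mulr0; split; apply: subgroup0.
- by move=> x y [Lx Dx] [Ly Dy]; rewrite mulrBr; split; apply: subgroupB.
Qed.

Lemma constructible_exponent C : constructible M L C ->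
  exists2 n, (0 < n)%N & forall x, L x -> C (x *+ n).
Proof.
have gL := lattice_subgroup.
elim=> [|a D Ma _ [n n0 Dn]|a D Ma _ [n n0 Dn]].
- by exists 1%N.
- have [k k0 Lk] := order_multiple_lattice.
  have [l l0 Rl] := order_clear_denominators oR a^-1.
  (* Here [l] brings [a^-1 * x] into [R], [k] brings the result into [L], and [n] brings it into
     [D]. *)
  exists (l * k * n)%N; first by rewrite !muln_gt0 l0 k0.
  move=> x Lx; exists ((a^-1 * x) *+ (l * k) *+ n).
    rewrite !mulrnA -mulrnAl; apply: Dn; apply: Lk.
    by apply: (order_mul oR Rl); exact: lattice_order.
  by rewrite -mulrnA mulrnAr mulVKr ?monoid_unit.
- exists n => // x Lx; split; first exact: subgroupMn.
  by rewrite mulrnAr; apply/Dn/lattice_mul.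
Qed.

(** [C] contains [k * n] times [R], and [R] has finitely many classes modulo that multiple. *)
Lemma constructible_finite_index C : constructible M L C ->
  exists t : seq A, forall x, L x -> exists2 c, c \in t & C (x - c).
Proof.
move=> cC; have [n n0 Cn] := constructible_exponent cC.
have [k k0 Lk] := order_multiple_lattice.
have [_ _ _ [s [sR _]]] := oR.
have [|t tP] := zcomb_finite_mod s (m := (k * n)%N); first by rewrite muln_gt0 k0.
exists t => x /lattice_order/sR/tP[c [y [ct /sR Ry e]]]; exists c => //.
by rewrite e mulrnA; apply/Cn/Lk.
Qed.

(** * Points of the inverse limit and compactness of the closure of the lattice *)

Lemma iota_eq C x x' : constructible M L C -> C (x - x') ->
  forall y, iota M L x C y <-> iota M L x' C y.
Proof.
move=> cC Cxx y; have gC := constructible_subgroup cC.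
split=> -[_ [Ly Cy]]; do 2?split=> //.
  by rewrite -(subrK x y) -addrA; apply: subgroupD.
by rewrite -(subrK x' y) -addrA -[x' - x]opprB; apply: subgroupB.
Qed.

Lemma iota_inj C x x' : constructible M L C -> L x ->
  (forall y, iota M L x C y <-> iota M L x' C y) -> C (x - x').
Proof.
move=> cC Lx e; have [_ [_]] : iota M L x' C x; last by [].
apply/e; do 2?split=> //; rewrite subrr.
exact: subgroup0 (constructible_subgroup cC).
Qed.

Lemma iota_point x : L x -> is_point M L (iota M L x).
Proof.
move=> Lx; split=> [D cD y []//|C cC|C D cC cD sCD y [_ [Ly Cy]]].
  by exists x => // y; split=> [[]//|].
by do 2?split=> //; apply: sCD.
Qed.

Lemma agree_sym Cs (xi eta : cpt A) : agree Cs xi eta -> agree Cs eta xi.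
Proof. by move=> e C /e eC y; split=> /eC. Qed.

Lemma agree_trans Cs (xi eta zeta : cpt A) :
  agree Cs xi eta -> agree Cs eta zeta -> agree Cs xi zeta.
Proof. by move=> e e' C CC y; rewrite (e C CC y) (e' C CC y). Qed.

Lemma agree_cat Cs Ds (xi eta : cpt A) :
  agree (Cs ++ Ds)%list xi eta <-> agree Cs xi eta /\ agree Ds xi eta.
Proof.
split=> [e|[e e'] C /List.in_app_iff[/e|/e']//].
by split=> C CC; apply: e; apply/List.in_app_iff; [left|right].
Qed.

(** Only finitely many constructible subgroups occur, so the product of their exponents works. *)
Lemma agree_exponent Cs : exists2 n, (0 < n)%N &
  forall x h, L h -> agree Cs (iota M L (x + h *+ n)) (iota M L x).
Proof.
elim: Cs => [|C Cs [n n0 IH]]; first by exists 1%N.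
case: (pselect (constructible M L C)) => [cC|ncC].
  have [m m0 Cm] := constructible_exponent cC.
  exists (m * n)%N; first by rewrite muln_gt0 m0.
  move=> x h Lh D [<-|DCs]; last first.
    by rewrite mulrnA; exact: (IH x _ (subgroupMn lattice_subgroup m Lh)).
  apply: iota_eq => //; rewrite addrAC subrr add0r.
  by rewrite mulnC mulrnA; apply/Cm/(subgroupMn lattice_subgroup).
(* At a non-constructible index [iota] is empty, so both sides are. *)
exists n => // x h Lh D [<-|]; last exact: IH.
by split=> -[].
Qed.

(* The inverse limit may contain points outside the closure of [L] when the
   constructible subgroups are not closed under intersection. *)
Definition limit_point (xi : cpt A) : Prop :=
  is_point M L xi /\ forall Cs, exists2 x, L x & agree Cs (iota M L x) xi.

Lemma iota_limit_point x : L x -> limit_point (iota M L x).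
Proof. by move=> Lx; split=> [|Cs]; [exact: iota_point | exists x]. Qed.

Lemma ultrafilter_cover (T : Type) (I : eqType) (F : set_system T) (t : seq I)
    (B : I -> set T) (D : set T) :
  UltraFilter F -> F D -> (forall p, D p -> exists2 c, c \in t & B c p) ->
  exists2 c, c \in t & F (B c).
Proof.
move=> UF; elim: t D => [|a t IH] D FD DB.
  by have [p /DB[]] := filter_ex FD.
have [Fa|FCa] := in_ultra_setVsetC (B a) UF; first by exists a; rewrite ?mem_head.
have [|c ct Fc] := IH _ (filterI FD FCa); last by exists c; rewrite // inE ct orbT.
by move=> p [/DB[c]]; rewrite inE => /orP[/eqP->|ct] Bc // nBa; exists c.
Qed.

(** Compactness of the closure of [L]: each [C] has finite index, so the ultrafilter concentrates on
    one coset of [C], and these cosets form the limit. *)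
Lemma ultrafilter_limit (T : Type) (F : set_system T) (f : T -> A) :
    UltraFilter F -> F [set p | L (f p)] ->
  exists2 xi, limit_point xi &
    forall Cs, F [set p | agree Cs (iota M L (f p)) xi].
Proof.
move=> UF FL.
(* [xi C] consists of the [y] in [L] congruent to [f p] modulo [C] for [F]-almost all [p]. *)
pose xi : cpt A := fun C y => constructible M L C /\ L y /\ F [set p | C (f p - y)].
have xiP C : constructible M L C -> exists c, [/\ L c, F [set p | C (f p - c)] &
    forall y, xi C y <-> (L y /\ C (y - c))].
  move=> cC; have gC := constructible_subgroup cC.
  have [t tP] := constructible_finite_index cC.
  have [c _ Fc] := ultrafilter_cover (B := fun c => [set p | C (f p - c)]) UF FL
    (fun p Lp => tP _ Lp).
  have [p [/= Lp Cp]] := filter_ex (filterI FL Fc).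
  have Lc : L c.
    rewrite -[c](subKr (f p)); apply: (subgroupB lattice_subgroup Lp).
    exact: constructible_sub cC Cp.
  exists c; split=> // y; split=> [[_ [Ly Fy]]|[Ly Cy]].
    split=> //; have [q [/= Cq Cq']] := filter_ex (filterI Fc Fy).
    by have := subgroupB gC Cq Cq'; rewrite opprB addrC addrA subrK.
  do 2?split=> //; apply: filterS Fc => q /= Cq.
  by have := subgroupB gC Cq Cy; rewrite opprB addrA subrK.
have FCs Cs : F [set p | agree Cs (iota M L (f p)) xi].
  elim: Cs => [|C Cs IH]; first by apply: filterS FL => p _ C [].
  case: (pselect (constructible M L C)) => [cC|ncC].
    have [c [Lc Fc xiC]] := xiP C cC.
    apply: filterS (filterI Fc IH) => p [/= Cp ag] D [<-|/ag //] y.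
    rewrite (iota_eq cC Cp) xiC; split=> [[]//|Ly]; by split.
  apply: filterS IH => p ag D [<-|/ag //] y; by split=> -[].
exists xi => //; split.
  split=> [D cD y []//|C cC|C D cC cD sCD y [_ [Ly Fy]]].
    by have [c [Lc _ xiC]] := xiP C cC; exists c.
  by do 2?split=> //; apply: filterS Fy => p; apply: sCD.
by move=> Cs; have [p [/= Lp ag]] := filter_ex (filterI FL (FCs Cs)); exists (f p).
Qed.

(** Compactness, by contradiction: pairs violating the period [n], for ever more divisible [n], have
    first entries converging to some [xi]; the second entries converge there too, although [f] is
    constant near [xi]. *)
Lemma locally_constant_periodic (T : Type) (f : A -> T) :
    (forall xi, limit_point xi -> exists Cs v,
        forall x, L x -> agree Cs xi (iota M L x) -> f x = v) ->
  exists2 n, (0 < n)%N & forall x h, L x -> L h -> f (x + h *+ n) = f x.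
Proof.
move=> loc; apply: contrapT => nper.
pose B n := [set p : A * A | [/\ L p.1, exists2 h, L h & p.2 = p.1 + h *+ n
  & f p.2 <> f p.1]].
pose F := filter_from [set n | (0 < n)%N] B.
(* Divisibility directs the sets [B n], so they form a filter base. *)
have Bm n m : (B (n * m)%N `<=` B n)%classic.
  move=> p [Lp [h Lh e] fp]; split=> //; exists (h *+ m); last first.
    by rewrite -mulrnA mulnC.
  exact: (subgroupMn lattice_subgroup).
have FF : ProperFilter F.
  apply: filter_from_proper.
    apply: filter_from_filter; first by exists 1%N.
    move=> i j /= i0 j0; exists (i * j)%N; first by rewrite /= muln_gt0 i0.
    by move=> p Bp; split; [apply: Bm Bp | move: Bp; rewrite mulnC; apply: Bm].
  move=> n /= n0; apply: contrapT => B0; apply: nper; exists n => // x h Lx Lh.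
  apply: contrapT => fxh; apply: B0; exists (x, x + h *+ n).
  by split=> //; exists h.
have [U [UU FU]] := ultraFilterLemma FF.
have UB n : (0 < n)%N -> U (B n) by move=> n0; apply: FU; exists n.
have [|xi lxi xiU] := @ultrafilter_limit _ U (fun p => p.1) UU.
  by apply: filterS (UB 1%N isT) => p [].
have [Cs [v fv]] := loc _ lxi.
have [n n0 ag] := agree_exponent Cs.
have [p [/= agp [Lp [h Lh e] fp]]] := filter_ex (filterI (xiU Cs) (UB n n0)).
apply: fp; rewrite (fv p.1 Lp (agree_sym agp)); apply: fv.
  rewrite e; apply: (subgroupD lattice_subgroup Lp).
  exact: (subgroupMn lattice_subgroup).
apply: agree_trans (agree_sym agp) _; rewrite e; apply/agree_sym/ag/Lh.
Qed.

End GoodTriple.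

(** * The partial action and its extension to the inverse limit *)

Lemma PactM (A : falgType rat) (g h : A * A) x :
  Pact (Pmul g h) x = Pact g (Pact h x).
Proof. by rewrite /Pact /= mulrDr !mulrA addrA. Qed.

Section PartialAction.
Variables (A : falgType rat) (R M L : A -> Prop).
Hypothesis tRML : good_triple R M L.

Let gL := lattice_subgroup tRML.

(** The hypothesis on [g.2] is what gives continuity: a difference [y - x] in [D] is sent into
    [C]. *)
Lemma ext_act_iota g x : Pdom L g x ->
    (forall C, constructible M L C -> exists2 D, constructible M L D &
       forall y, D y -> C (g.2 * y)) ->
  ext_act M L g (iota M L x) (iota M L (Pact g x)).
Proof.
move=> [Lx Lgx] gC; split; [exact: iota_point..| |].
  by move=> Cs; exists x.
elim=> [|C Cs [Ds IH]]; first by exists nil => ? _ _ ? [].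
case: (pselect (constructible M L C)) => [cC|ncC]; last first.
  exists Ds => y dy ag E [<-|]; first by split=> -[].
  exact: IH.
have [D cD DC] := gC C cC.
exists (D :: Ds) => y dy ag E [<-|EC]; last first.
  by apply: IH EC => // E' E'D; apply: ag; right.
apply: (iota_eq tRML) => //; rewrite /Pact opprD addrACA subrr add0r -mulrBr.
by apply: DC; apply: (iota_inj tRML) => //; [case: dy | apply: ag; left].
Qed.

Lemma ext_act_translation l x :
  L l -> L x -> ext_act M L (l, 1) (iota M L x) (iota M L (l + x)).
Proof.
move=> Ll Lx; have -> : l + x = Pact (l, 1) x by rewrite /Pact mul1r.
apply: ext_act_iota.
  by split=> //; rewrite /Pact mul1r; apply: subgroupD.
by move=> C cC; exists C => // y; rewrite mul1r.
Qed.

Lemma ext_act_dilation a x :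
  M a -> L x -> ext_act M L (0, a) (iota M L x) (iota M L (a * x)).
Proof.
move=> Ma Lx; have -> : a * x = Pact (0, a) x by rewrite /Pact add0r.
apply: ext_act_iota.
  by split=> //; rewrite /Pact add0r; apply: lattice_mul tRML _ _ _ _.
by move=> C cC; exists (fun y => L y /\ C (a * y)); [exact: consPre | move=> y []].
Qed.

(** Stated at all limit points, not only at points of [L], because the compactness argument needs
    local constancy at each of them. *)
Lemma translation_arrow l xi :
  L l -> limit_point M L xi -> is_arrow M L ((l, 1), xi).
Proof.
move=> Ll [[xi0 xiC xiS] dxi].
have xiL C y : xi C y -> L y.
  case: (pselect (constructible M L C)) => [/xiC[x _ e] /e[]//|/xi0 n /n //].
have Dom x : L x -> Pdom L (l, 1) x.
  by move=> Lx; split=> //; rewrite /Pact mul1r; apply: subgroupD.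
split; first exact: translation_inP tRML _ _.
(* The image of [xi] is [xi] with every coset shifted by [l]. *)
exists (fun C y => xi C (y - l)); split.
- by [].
- split=> [D /xi0 n y /n //|C cC|C D cC cD sCD y].
    have [x Lx e] := xiC C cC; exists (l + x); first exact: subgroupD.
    move=> y; rewrite e opprD addrA; split=> -[Ly Cy]; split=> //.
      by rewrite -(subrK l y); apply: subgroupD.
    exact: subgroupB.
  exact: xiS.
- by move=> Cs; have [x Lx ag] := dxi Cs; exists x; split=> //; apply: Dom.
move=> Cs; exists Cs => x [Lx _] /= ag C CCs y; rewrite -(ag C CCs).
rewrite /iota /Pact mul1r opprD addrA; split=> -[cC [Ly Cy]]; do 2?split=> //.
  exact: subgroupB.
by rewrite -(subrK l y); apply: subgroupD.
Qed.

Lemma iota_translation_arrow l x : L l -> L x -> is_arrow M L ((l, 1), iota M L x).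
Proof. by move=> Ll Lx; apply: translation_arrow => //; apply: iota_limit_point. Qed.

Lemma iota_dilation_arrow a x : M a -> L x -> is_arrow M L ((0, a), iota M L x).
Proof.
move=> Ma Lx; split; first exact: dilation_inP tRML _ _.
by exists (iota M L (a * x)); apply: ext_act_dilation.
Qed.

(** For [u = a^-1 * b] the domain consists of the [x] in [L] with [b * x] in [a L]: a preimage of an
    image. *)
Lemma gen_group_domain u : gen_group M u ->
  exists2 C, constructible M L C & forall x, C x <-> (L x /\ L (u * x)).
Proof.
case/(gen_group_fraction tRML) => a [b [Ma Mb ->]].
exists (fun x => L x /\ exists2 c, L c & b * x = a * c).
  exact: consPre (consMul Ma (consL _ _)).
move=> x; split=> -[Lx]; rewrite -mulrA.
  by case=> c Lc ->; rewrite mulKr // (monoid_unit tRML).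
by move=> Lc; split=> //; exists (a^-1 * (b * x)); rewrite ?mulVKr ?(monoid_unit tRML).
Qed.

(* The domain of [g] in [L] is a coset of a constructible subgroup, hence clopen. *)
Lemma Pdom_near g xi : gen_group M g.2 ->
    (forall Cs, exists x, Pdom L g x /\ agree Cs (iota M L x) xi) ->
  exists Cs, forall x, L x -> agree Cs (iota M L x) xi -> Pdom L g x.
Proof.
move=> /gen_group_domain[C cC CP] dxi; exists [:: C] => x Lx ag.
have [y [[Ly Lgy] agy]] := dxi [:: C].
have /CP[_ Lu] : C (x - y).
  apply: (iota_inj tRML) => //.
  by apply: (agree_trans ag (agree_sym agy)); left.
split=> //; rewrite -(subrK (Pact g y) (Pact g x)); apply: subgroupD => //.
by rewrite /Pact opprD addrACA subrr add0r -mulrBr.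
Qed.

(** The product may be defined at a point of [L] where [g] is not; this does not happen near [xi],
    since the domain of [g] is clopen. *)
Lemma ext_act_comp g h xi eta zeta : gen_group M g.2 -> gen_group M h.2 ->
    ext_act M L g xi eta -> ext_act M L h eta zeta ->
  ext_act M L (Pmul h g) xi zeta.
Proof.
move=> Gg Gh [pxi peta dg cg] [_ pzeta dh ch].
have [Cg CgP] := Pdom_near Gg dg; have [Ch ChP] := Pdom_near Gh dh.
split=> // Cs.
  have [Ds DsP] := cg Ch.
  have [x [dx /agree_cat[ag agD]]] := dg (Cs ++ Ds)%list.
  have [_ Lhx] := ChP _ dx.2 (DsP x dx agD).
  by exists x; split=> //; split; [case: dx | rewrite PactM].
have [Ds DsP] := ch Cs; have [Es EsP] := cg (Ch ++ Ds)%list.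
exists (Cg ++ Es)%list => x [Lx _] /agree_cat[agC agE].
have dx := CgP x Lx agC; have [agh agD] := (agree_cat _ _ _ _).1 (EsP x dx agE).
by rewrite PactM; apply: DsP => //; apply: ChP agh; case: dx.
Qed.

Lemma composable_arrow gam del : is_arrow M L gam -> is_arrow M L del ->
  composable M L gam del -> is_arrow M L (amul gam del).
Proof.
move=> [Pg [zeta ez]] [Pd _] e; split; first exact: Pmul_inP tRML _ _ _ _.
by exists zeta; apply: ext_act_comp e ez; [case: Pd | case: Pg].
Qed.

End PartialAction.

(** * The cocycle of a groupoid embedding *)

Section Embedding.
Variables (A1 A2 : falgType rat) (R1 M1 L1 : A1 -> Prop) (R2 M2 L2 : A2 -> Prop).
Hypothesis t1 : good_triple R1 M1 L1.
Hypothesis t2 : good_triple R2 M2 L2.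

(** A one-sided part of the notion of isomorphism, so that the construction applies to an
    isomorphism and to its inverse alike. *)
Definition groupoid_embedding (Phi : arrow A1 -> arrow A2) : Prop :=
  [/\ forall gam, is_arrow M1 L1 gam -> is_arrow M2 L2 (Phi gam),
      forall gam del, is_arrow M1 L1 gam -> is_arrow M1 L1 del ->
        Phi gam = Phi del -> gam = del,
      forall gam2 gam1, is_arrow M1 L1 gam2 -> is_arrow M1 L1 gam1 ->
        composable M1 L1 gam2 gam1 ->
        Phi (amul gam2 gam1) = amul (Phi gam2) (Phi gam1) &
      forall U, gopen M2 L2 U ->
        gopen M1 L1 (fun gam => is_arrow M1 L1 gam /\ U (Phi gam))].

Lemma groupoid_iso_embedding Phi :
  groupoid_iso M1 L1 M2 L2 Phi -> groupoid_embedding Phi.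
Proof. by case=> [? [? [_ [_ [? [? _]]]]]]. Qed.

Section Cocycle.
Variable Phi : arrow A1 -> arrow A2.
Hypothesis eP : groupoid_embedding Phi.

Let gL1 := lattice_subgroup t1.
Let L10 := subgroup0 gL1.

Definition cocycle (g : A1 * A1) (x : A1) : A2 * A2 := (Phi (g, iota M1 L1 x)).1.

Lemma cocycleM g h x y :
    is_arrow M1 L1 (g, iota M1 L1 y) -> is_arrow M1 L1 (h, iota M1 L1 x) ->
    ext_act M1 L1 h (iota M1 L1 x) (iota M1 L1 y) ->
  cocycle (Pmul g h) x = Pmul (cocycle g y) (cocycle h x).
Proof. by case: eP => _ _ PhiM _ ag ah e; exact: (congr1 fst (PhiM _ _ ag ah e)). Qed.

Lemma cocycle_inP g x : is_arrow M1 L1 (g, iota M1 L1 x) -> inP M2 L2 (cocycle g x).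
Proof. by case: eP => Phia _ _ _ /Phia[]. Qed.

Lemma cocycle_translationD l m x : L1 l -> L1 m -> L1 x ->
  cocycle (l + m, 1) x = Pmul (cocycle (l, 1) (m + x)) (cocycle (m, 1) x).
Proof.
move=> Ll Lm Lx; rewrite -(@cocycleM _ _ x (m + x)) /Pmul /= ?mul1r //.
- by apply: iota_translation_arrow t1 _ _ _ _ => //; apply: subgroupD.
- exact: iota_translation_arrow t1 _ _ _ _.
- exact: ext_act_translation t1 _ _ _ _.
Qed.

(** The cocycle identity makes the value idempotent, and an idempotent of a group is its
    identity. *)
Lemma cocycle_unit x : L1 x -> cocycle (0, 1) x = (0, 1).
Proof.
move=> Lx; have := cocycle_translationD L10 L10 Lx; rewrite !add0r.
have [_ /(gen_group_unit t2)] := cocycle_inP (iota_translation_arrow t1 L10 Lx).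
case: (cocycle _ _) => b u /= uu [eb eu].
have u1 : u = 1 by apply: (mulrI uu); rewrite -eu mulr1.
have -> : b = 0 by apply: (addrI b); rewrite addr0 [RHS]eb u1 mul1r.
by rewrite u1.
Qed.

Lemma cocycle_translation_inj l x : L1 l -> L1 x -> cocycle (l, 1) x = (0, 1) -> l = 0.
Proof.
move=> Ll Lx cl; have [_ Phi_inj PhiM _] := eP.
have al := iota_translation_arrow t1 Ll Lx.
have a0 := iota_translation_arrow t1 L10 Lx.
have := ext_act_translation t1 L10 Lx; rewrite add0r => e0.
(* Composing with the unit arrow at [iota x] shows that both images have the same source. *)
have := PhiM _ _ al a0 e0; rewrite {1}/amul /Pmul /= !mul1r addr0 => e.
suff /(congr1 (fun gam : arrow A1 => gam.1.1)) :
  ((l, 1), iota M1 L1 x) = ((0, 1), iota M1 L1 x) :> arrow A1 by [].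
apply: Phi_inj => //; rewrite e /amul -!/(cocycle _ _) cl cocycle_unit //.
rewrite [RHS]surjective_pairing -/(cocycle (0, 1) x) cocycle_unit //.
by rewrite /Pmul /= !mul1r addr0.
Qed.

(** The group is discrete, so fixing the group component of an arrow is an open condition, which
    pulls back along [Phi]. *)
Lemma cocycle_locally_constant g xi : is_arrow M1 L1 (g, xi) ->
  exists Cs v, forall x, is_arrow M1 L1 (g, iota M1 L1 x) ->
    agree Cs xi (iota M1 L1 x) -> cocycle g x = v.
Proof.
move=> axi; have [Phia _ _ Phic] := eP.
pose v := (Phi (g, xi)).1.
have [|_ /(_ g xi)[|Cs CsP]] := Phic (fun gam => is_arrow M2 L2 gam /\ gam.1 = v).
- split=> [gam []//|h eta [_ /= ->]]; exists nil => zeta az _; by split.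
- by split=> //; split=> //; apply: Phia.
by exists Cs, v => x ax /(CsP _ ax)[_ [_]].
Qed.

(** Compactness gives a period for each generator of [R1]; by the cocycle identity the [r] with
    period [n] form a subgroup, so one [n] serves all of [R1]. *)
Lemma translation_cocycle_periodic : exists k n, [/\ (0 < k)%N, (0 < n)%N,
  forall r, R1 r -> L1 (r *+ k) &
  forall r x h, R1 r -> L1 x -> L1 h ->
    cocycle (r *+ k, 1) (x + h *+ n) = cocycle (r *+ k, 1) x].
Proof.
have [k k0 Lk] := order_multiple_lattice t1.
have oR : is_lattice_order R1 by case: t1.
have [_ _ _ [s [sR _]]] := oR.
pose P (r : A1) n := forall x h, L1 x -> L1 h ->
  cocycle (r *+ k, 1) (x + h *+ n) = cocycle (r *+ k, 1) x.
have [|r rs|n n0 Pn] := @common_multiple _ P s.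
- move=> r n m m0 Pr x h Lx Lh; rewrite mulnC mulrnA; apply: Pr => //.
  exact: subgroupMn.
- have Lr : L1 (r *+ k) by apply/Lk/sR/mem_zcomb.
  apply: (locally_constant_periodic t1) => xi lxi.
  have [Cs [v vP]] := cocycle_locally_constant (translation_arrow t1 Lr lxi).
  by exists Cs, v => x Lx; apply: vP; apply: iota_translation_arrow t1 _ _ _ _.
suff key r : zcomb s r -> R1 r /\ P r n.
  by exists k, n; split=> // r x h /sR/key[_]; apply.
apply: (@zcomb_subgroup _ s (fun r => R1 r /\ P r n)) => [|y ys]; last first.
  by split; [apply/sR/mem_zcomb | apply: Pn].
have gR := order_subgroup oR.
split=> [|u v [Ru Pu] [Rv Pv]].
  split; first exact: subgroup0.
  move=> x h Lx Lh; rewrite mul0rn !cocycle_unit //.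
  by apply: subgroupD => //; apply: subgroupMn.
split; first exact: subgroupB.
move=> x h Lx Lh; rewrite mulrnBl.
have [Lu Lv] : L1 (u *+ k) /\ L1 (v *+ k) by split; apply: Lk.
have Lv' : L1 (- (v *+ k)) by apply: subgroupN.
have Lxh : L1 (x + h *+ n) by apply: subgroupD => //; apply: subgroupMn.
rewrite !cocycle_translationD // addrA Pu //; last exact: subgroupD.
congr (Pmul _ _).
(* A value for [- v] inverts a value for [v], so it inherits the period by cancellation. *)
have inv y : L1 y -> Pmul (cocycle (v *+ k, 1) (- (v *+ k) + y))
    (cocycle (- (v *+ k), 1) y) = (0, 1).
  by move=> Ly; rewrite -cocycle_translationD // subrr cocycle_unit.
have := inv _ Lxh; rewrite -(inv _ Lx) addrA Pv //; last exact: subgroupD.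
have Lvx : L1 (- (v *+ k) + x) by apply: subgroupD.
have [_ /(gen_group_unit t2)] := cocycle_inP (iota_translation_arrow t1 Lv Lvx).
case: (cocycle _ _) => b w /= uw; case: (cocycle _ _) => c z.
case: (cocycle _ _) => c' z' [/addrI/(mulrI uw)-> /(mulrI uw)->//].
Qed.

(* Conjugation by [cocycle (0, a) 0] acts trivially on the [<M2>]-component of the
   homomorphism [r |-> cocycle (r *+ K, 1) 0], so that component dies on multiples
   of [1 - a]; injectivity of [1 - a] turns these into a finite index subgroup. *)
Lemma equivariant_additive_map :
    (exists a, M1 a /\ forall x y, L1 x -> L1 y ->
       (1 - a) * x = (1 - a) * y -> x = y) ->
  exists (tau mu : A1 -> A2),
    [/\ forall x y, R1 x -> R1 y -> tau (x + y) = tau x + tau y,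
        forall x, R1 x -> tau x = 0 -> x = 0,
        forall a, M1 a -> gen_group M2 (mu a) &
        forall a x, M1 a -> R1 x -> tau (a * x) = mu a * tau x].
Proof.
move=> [a0 [Ma0 inj_a0]].
have oR : is_lattice_order R1 by case: t1.
have gR := order_subgroup oR.
have [k [n [k0 n0 Lk per]]] := translation_cocycle_periodic.
(* Multiples by [k] lie in [L1] and [n] is a period, so a base point [r *+ K] may be replaced by
   0. *)
pose K := (n * k)%N.
have K0 : (0 < K)%N by rewrite muln_gt0 n0.
have LK r : R1 r -> L1 (r *+ K).
  by move=> Rr; rewrite mulrnA; apply/Lk/(subgroupMn gR).
pose sg r := cocycle (r *+ K, 1) 0.
have arK r : R1 r -> is_arrow M1 L1 ((r *+ K, 1), iota M1 L1 0).
  by move=> Rr; apply: iota_translation_arrow t1 _ _ _ _ => //; apply: LK.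
have sgP r : R1 r -> inP M2 L2 (sg r) by move=> /arK/cocycle_inP.
have sgD r r' : R1 r -> R1 r' -> sg (r + r') = Pmul (sg r) (sg r').
  move=> Rr Rr'; rewrite /sg mulrnDl cocycle_translationD //; try exact: LK.
  congr (Pmul _ _); rewrite addrC {2}/K mulnC !mulrnA per //.
    exact: subgroupMn.
  exact: Lk.
pose mu a := cocycle (0, a) 0.
have muP a : M1 a -> inP M2 L2 (mu a).
  by move=> Ma; apply: cocycle_inP; apply: iota_dilation_arrow t1 _ _ _ _.
(* Both sides are the cocycle at 0 of a translation followed by the dilation by [a]; [d] brings the
   translated point so close to 0 that the value for [(0, a)] does not change. *)
have conj a : M1 a -> exists2 d, (0 < d)%N & forall r, R1 r ->
    Pmul (sg (a * (r *+ d))) (mu a) = Pmul (mu a) (sg (r *+ d)).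
  move=> Ma; have Ra := monoid_order t1 Ma.
  have a0a := iota_dilation_arrow t1 Ma L10.
  have [Cs [v vP]] := cocycle_locally_constant a0a.
  have [d d0 ag] := agree_exponent t1 Cs.
  exists d => // r Rr.
  have Rd : R1 (r *+ d) by apply: subgroupMn.
  have Rad : R1 (a * (r *+ d)) by apply: order_mul.
  have := ext_act_dilation t1 Ma L10; rewrite mulr0 => e0.
  rewrite /sg /mu -(@cocycleM _ _ 0 0) //; last exact: arK.
  have := ext_act_translation t1 (LK _ Rd) L10; rewrite addr0 => e1.
  have ad : is_arrow M1 L1 ((0, a), iota M1 L1 (r *+ d *+ K)).
    by apply: iota_dilation_arrow t1 _ _ _ _ => //; apply: LK.
  have -> : cocycle (0, a) 0 = cocycle (0, a) (r *+ d *+ K).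
    rewrite !(vP _) //; apply: agree_sym; rewrite mulrnAC -[_ *+ d]add0r.
    by apply: ag; apply: LK.
  rewrite -(cocycleM ad (arK _ Rd) e1) /Pmul /= mulr0 mul1r addr0 add0r mulr1.
  by rewrite !mulrnAr.
have sg2 r : R1 r -> (sg r).2 \is a GRing.unit.
  by move=> /sgP[_]; apply: (gen_group_unit t2).
have [N N0 sgN] : exists2 N, (0 < N)%N & forall r, R1 r -> (sg (r *+ N)).2 = 1.
  have [d d0 cd] := conj a0 Ma0; have Ra0 := monoid_order t1 Ma0.
  have ua : 1 - a0 \is a GRing.unit.
    apply: (order_regular_unit oR) => x Rx ax0.
    apply: (mulrn_inj k0); rewrite mul0rn; apply: inj_a0 => //; first exact: Lk.
    by rewrite mulrnAr ax0 mul0rn mulr0.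
  have [e e0 Re] := order_clear_denominators oR (1 - a0)^-1.
  exists (e * d)%N => [|r Rr]; first by rewrite muln_gt0 e0.
  (* [q] is chosen so that [r *+ (e * d)] equals [1 - a0] times [q *+ d]. *)
  pose q := (1 - a0)^-1 *+ e * r.
  have Rq : R1 q by apply: order_mul.
  have Rqd : R1 (q *+ d) by apply: subgroupMn.
  have -> : r *+ (e * d) = q *+ d - a0 * (q *+ d).
    rewrite -{1}[q *+ d]mul1r -mulrBl mulrnAr /q mulrnAl.
    by rewrite mulrnAr mulVKr // mulrnA.
  have Raqd : R1 (a0 * (q *+ d)) by apply: order_mul.
  have := sgD _ _ (subgroupB gR Rqd Raqd) Raqd; rewrite subrK => /(congr1 snd) /= e2.
  have /(congr1 snd) /= := cd _ Rq.
  (* In the commutative second component the conjugation cancels, so [q *+ d] and [a0 * (q *+ d)]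
     have equal components. *)
  rewrite [RHS](algebra_commutative t2).
  move=> /(mulIr (gen_group_unit t2 (muP _ Ma0).2)) e3.
  by apply: (mulIr (sg2 _ Raqd)); rewrite -e2 mul1r e3.
have RN r : R1 r -> R1 (r *+ N) by move=> Rr; apply: subgroupMn.
pose tau r := (sg (r *+ N)).1.
have tauD x y : R1 x -> R1 y -> tau (x + y) = tau x + tau y.
  move=> Rx Ry; rewrite /tau mulrnDl (sgD _ _ (RN _ Rx) (RN _ Ry)).
  by rewrite -[LHS]/((sg (x *+ N)).1 + (sg (x *+ N)).2 * (sg (y *+ N)).1) sgN // mul1r.
exists tau, (fun a => (mu a).2); split=> //.
- move=> x Rx tx; have : sg (x *+ N) = (0, 1).
    by rewrite [LHS]surjective_pairing sgN // -/(tau x) tx.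
  move/cocycle_translation_inj => /(_ (LK _ (RN _ Rx)) L10).
  rewrite -mulrnA => e; apply: (@mulrn_inj _ (N * K)%N); last by rewrite e mul0rn.
  by rewrite muln_gt0 N0.
- by move=> a /muP[].
move=> a x Ma Rx; have Ra := monoid_order t1 Ma.
have tauMn y m : R1 y -> tau (y *+ m) = tau y *+ m.
  exact: (subgroup_additiveMn gR m tauD).
have [d d0 /(_ _ (RN _ Rx))] := conj a Ma.
have Rad : R1 (a * (x *+ d)) by apply: order_mul => //; apply: subgroupMn.
rewrite mulrnAC mulrnAr => /(congr1 fst) e.
have {}e : tau (a * (x *+ d)) + (sg (a * (x *+ d) *+ N)).2 * (mu a).1 =
    (mu a).1 + (mu a).2 * tau (x *+ d) := e.
(* The second component is 1 on these multiples, so the translation part [(mu a).1] cancels. *)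
move: e; rewrite sgN // mul1r addrC => /addrI.
have Rax : R1 (a * x) by apply: order_mul.
by rewrite mulrnAr !tauMn // mulrnAr; apply: mulrn_inj d0 _ _.
Qed.

End Cocycle.
End Embedding.

(** * From the isomorphism and its inverse to linear maps and algebra isomorphisms *)

Lemma groupoid_iso_inverse_embedding (A1 A2 : falgType rat)
    (R1 M1 L1 : A1 -> Prop) (M2 L2 : A2 -> Prop) Phi :
    good_triple R1 M1 L1 -> groupoid_iso M1 L1 M2 L2 Phi ->
  exists Psi, groupoid_embedding M2 L2 M1 L1 Psi.
Proof.
move=> t1 [Phia [Phi_inj [Phi_surj [Phic [PhiM [_ Phi_open]]]]]].
have inv (gam' : arrow A2) : exists gam, is_arrow M2 L2 gam' ->
    is_arrow M1 L1 gam /\ Phi gam = gam'.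
  case: (pselect (is_arrow M2 L2 gam')) => [/Phi_surj[gam ag e]|n]; first by exists gam.
  (* Off the arrow space the value is arbitrary. *)
  by exists ((0, 0), fun _ _ => False).
have [Psi PsiP] := choice inv; exists Psi; split.
- by move=> gam /PsiP[].
- by move=> gam del /PsiP[_ eg] /PsiP[_ ed] e; rewrite -eg -ed e.
- move=> gam2 gam1 a2 a1; have [[b2 e2] [b1 e1]] := (PsiP _ a2, PsiP _ a1).
  rewrite -{1}e2 -{1}e1 => /(Phic _ _ b2 b1) c.
  have e := PhiM _ _ b2 b1 c; rewrite e2 e1 in e.
  (* The product must be an arrow before [Phi] can be cancelled. *)
  have b := composable_arrow t1 b2 b1 c.
  have := Phia _ b; rewrite e => /PsiP[b' e'].
  by apply: Phi_inj => //; rewrite e.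
- move=> U oU; have [sub op] := Phi_open U oU; have [sU _] := oU.
  (* Preimages under [Psi] are images under [Phi], which is open. *)
  have key gam' : is_arrow M2 L2 gam' /\ U (Psi gam') <->
      exists2 gam, U gam & Phi gam = gam'.
    split=> [[/PsiP[_ e] Ug]|[gam Ug <-]]; first by exists (Psi gam').
    have ag := Phia _ (sU _ Ug); split=> //.
    by have [b /(Phi_inj _ _ b (sU _ Ug))->] := PsiP _ ag.
  split=> [gam []//|g xi /key/op[Cs CsP]]; exists Cs => eta ae ag.
  by apply/key; apply: CsP.
Qed.

(** Divide the value at a multiple lying in [R]; additive maps between rational vector spaces are
    linear. *)
Lemma extend_order_additive (A1 A2 : falgType rat) (R : A1 -> Prop) (tau : A1 -> A2) :
    is_lattice_order R ->
    (forall x y, R x -> R y -> tau (x + y) = tau x + tau y) ->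
  exists f : 'Hom(A1, A2), forall x, R x -> f x = tau x.
Proof.
move=> oR tauD; have gR := order_subgroup oR.
have tauMn y m : R y -> tau (y *+ m) = tau y *+ m.
  exact: (subgroup_additiveMn gR m tauD).
(* Asking for all [m] at once makes the value independent of the multiple chosen. *)
have ex x : exists y : A2, forall m, R (x *+ m) -> y *+ m = tau (x *+ m).
  have [k k0 Rk] := order_clear_denominators oR x.
  exists (k%:R^-1 *: tau (x *+ k)) => m Rm; apply: (mulrn_inj k0) => /=.
  rewrite -mulrnA mulnC mulrnA -[X in X *+ m]scaler_nat scalerA divff ?scale1r.
    by rewrite -!tauMn // -!mulrnA mulnC.
  by rewrite pnatr_eq0 -lt0n.
have [rho rhoE] := choice ex.
have rhoB : zmod_morphism rho.
  move=> x y; have [k k0 Rk] := order_clear_denominators oR x.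
  have [l l0 Rl] := order_clear_denominators oR y.
  have Rx : R (x *+ (k * l)) by rewrite mulrnA; apply: subgroupMn.
  have Ry : R (y *+ (k * l)) by rewrite mulnC mulrnA; apply: subgroupMn.
  have kl0 : (0 < k * l)%N by rewrite muln_gt0 k0.
  have Rxy : R ((x - y) *+ (k * l)) by rewrite mulrnBl; apply: subgroupB.
  apply: (mulrn_inj kl0); rewrite /= mulrnBl !rhoE //.
  by apply/eqP; rewrite eq_sym subr_eq -tauD // mulrnBl subrK.
have rho_lin : linear rho.
  have rho0 : rho 0 = 0 by rewrite -{1}(subrr 0) rhoB subrr.
  move=> c x y; have -> : c *: x + y = c *: x - (0 - y) by rewrite sub0r opprK.
  by rewrite !rhoB rho0 sub0r opprK (rat_linear rhoB).
pose g : {linear A1 -> A2} :=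
  HB.pack rho (GRing.isLinear.Build rat A1 A2 *:%R rho rho_lin).
by exists (linfun g) => x Rx; rewrite lfunE /= -[LHS]mulr1n rhoE.
Qed.

(** Injectivity and equivariance pass from [R1] to the algebra by clearing denominators. *)
Lemma embedding_equivariant_map (A1 A2 : falgType rat)
    (R1 M1 L1 : A1 -> Prop) (R2 M2 L2 : A2 -> Prop) Phi :
    good_triple R1 M1 L1 -> good_triple R2 M2 L2 ->
    groupoid_embedding M1 L1 M2 L2 Phi ->
    (exists a, M1 a /\ forall x y, L1 x -> L1 y ->
       (1 - a) * x = (1 - a) * y -> x = y) ->
  exists (f : 'Hom(A1, A2)) (mu : A1 -> A2),
    [/\ lker f == 0%VS, forall a, M1 a -> gen_group M2 (mu a) &
        forall a x, M1 a -> f (a * x) = mu a * f x].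
Proof.
move=> t1 t2 eP ha; have oR : is_lattice_order R1 by case: t1.
have [tau [mu [tauD tau0 mug tauM]]] := equivariant_additive_map t1 t2 eP ha.
have [f fE] := extend_order_additive oR tauD.
exists f, mu; split=> // [|a x Ma].
  apply/eqP/vspaceP => x; rewrite memv_ker memv0.
  apply/eqP/eqP => [fx0|->]; last exact: linear0.
  have [k k0 Rk] := order_clear_denominators oR x.
  apply: (mulrn_inj k0); rewrite mul0rn; apply: tau0 => //.
  by rewrite -fE // linearMn /= fx0 mul0rn.
have [k k0 Rk] := order_clear_denominators oR x.
apply: (mulrn_inj k0) => /=; rewrite -mulrnAr -!linearMn /= -mulrnAr.
by rewrite !fE ?tauM //; apply: order_mul => //; apply: monoid_order t1 _ Ma.
Qed.

Lemma equivariant_map_algebra_iso (A1 A2 : falgType rat)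
    (R1 M1 L1 : A1 -> Prop) (R2 M2 L2 : A2 -> Prop)
    (f : 'Hom(A1, A2)) (mu : A1 -> A2) :
    good_triple R1 M1 L1 -> good_triple R2 M2 L2 -> bijective f ->
    (forall a, M1 a -> gen_group M2 (mu a)) ->
    (forall a x, M1 a -> f (a * x) = mu a * f x) ->
  exists2 phi : A1 -> A2, Qalg_iso phi & forall m, M1 m -> Mtilde M2 (phi m).
Proof.
move=> t1 t2 [h fK hK] mug fM.
(* On [M1] the factor is [mu a], and this extends to the rational span; by surjectivity some factor
   inverts [f 1]. *)
have fact x : exists y, f x = y * f 1.
  move: x; apply: (monoid_Qspan_ind t1).
  - by exists 0; rewrite linear0 mul0r.
  - by move=> x y [u ex] [v ey]; exists (u + v); rewrite linearD /= ex ey mulrDl.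
  - by move=> c x [u ex]; exists (c *: u); rewrite linearZ /= ex scalerAl.
  - by move=> a Ma; exists (mu a); rewrite -fM // mulr1.
have uf : f 1 \is a GRing.unit.
  have [y] := fact (h 1); rewrite hK => e; apply/unitrP; exists y.
  by rewrite -e (algebra_commutative t2).
pose phi x := f x / f 1.
have phi_mu a : M1 a -> phi a = mu a.
  by move=> Ma; rewrite /phi -[a in LHS]mulr1 fM // mulrK.
have phiD x y : phi (x + y) = phi x + phi y by rewrite /phi linearD mulrDl.
have phiZ (c : rat) x : phi (c *: x) = c *: phi x.
  by rewrite /phi linearZ /= scalerAl.
(* Checked with the left factor in [M1], where [phi] is [mu], and extended linearly. *)
have phiM x y : phi (x * y) = phi x * phi y.
  move: x y; apply: (monoid_Qspan_ind t1) => [y|x x' IH IH' y|c x IH y|a Ma y].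
  - by rewrite mul0r /phi linear0 !mul0r.
  - by rewrite mulrDl !phiD mulrDl IH IH'.
  - by rewrite -scalerAl !phiZ IH scalerAl.
  - by rewrite (phi_mu a Ma) /phi fM // mulrA.
have phi1 : phi 1 = 1 by rewrite /phi mulrV.
exists phi; first split=> //.
  exists (fun y => h (y * f 1)) => x; first by rewrite /phi divrK.
  by rewrite /phi hK mulrK.
move=> m Mm; split; first by rewrite phi_mu //; apply: mug.
have oR : is_lattice_order R1 by case: t1.
(* Being a ring homomorphism, [phi] carries the monic equation of [m] to one for [phi m]. *)
have [p [pm pr]] := order_integral oR (monoid_order t1 Mm).
exists p; split=> //; have phi0 : phi 0 = 0 by rewrite /phi linear0 mul0r.
have phiX k : phi (m ^+ k) = phi m ^+ k.
  by elim: k => [|k IH]; rewrite ?expr0 // !exprS phiM IH.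
rewrite -phi0 -pr !(@horner_coef_wide _ (size p)) ?size_poly //.
rewrite (big_morph phi phiD phi0).
apply: eq_bigr => i _; rewrite phiM phiX !coef_map /=; congr (_ * _).
by rewrite -[in RHS]scaler_int phiZ phi1 scaler_int.
Qed.

Theorem theorem5p3 (A1 A2 : falgType rat)
    (R1 M1 L1 : A1 -> Prop) (R2 M2 L2 : A2 -> Prop) :
  good_triple R1 M1 L1 -> good_triple R2 M2 L2 ->
  (exists a, M1 a /\ forall x y, L1 x -> L1 y -> (1 - a) * x = (1 - a) * y -> x = y) ->
  (exists a', M2 a' /\ forall x y, L2 x -> L2 y -> (1 - a') * x = (1 - a') * y -> x = y) ->
  groupoids_isomorphic M1 L1 M2 L2 ->
  exists (phi1 : A1 -> A2) (phi2 : A2 -> A1),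
    [/\ Qalg_iso phi1, Qalg_iso phi2,
        (forall m, M1 m -> Mtilde M2 (phi1 m)) &
        (forall m, M2 m -> Mtilde M1 (phi2 m))].
Proof.
move=> t1 t2 h1 h2 [Phi iso].
have [Psi eQ] := groupoid_iso_inverse_embedding t1 iso.
have eP := groupoid_iso_embedding iso.
have [f [mu [f0 fg fM]]] := embedding_equivariant_map t1 t2 eP h1.
have [g [nu [g0 gg gM]]] := embedding_equivariant_map t2 t1 eQ h2.
(* Injections both ways force equal dimensions, so [u] is onto. *)
have bij (B1 B2 : falgType rat) (u : 'Hom(B1, B2)) (v : 'Hom(B2, B1)) :
    lker u == 0%VS -> lker v == 0%VS -> bijective u.
  move=> u0 v0; have u_inj := lker0P u0.
  have du : \dim (limg u) = \dim {:B1} by rewrite limg_dim_eq // (eqP u0) capv0.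
  have dv : \dim (limg v) = \dim {:B2} by rewrite limg_dim_eq // (eqP v0) capv0.
  have full : limg u = fullv.
    by apply/eqP; rewrite eqEdim subvf du -dv dimvS // subvf.
  have inv y : exists x, u x = y.
    by have /memv_imgP[x _ ->] : y \in limg u; [rewrite full memvf | exists x].
  have [w wK] := choice inv; exists w => // x; exact: u_inj.
have [phi1 i1 m1] := equivariant_map_algebra_iso t1 t2 (bij _ _ _ _ f0 g0) fg fM.
have [phi2 i2 m2] := equivariant_map_algebra_iso t2 t1 (bij _ _ _ _ g0 f0) gg gM.
by exists phi1, phi2.
Qed.
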